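(* Let $\lambda$ be a cardinal number, $\{X_\alpha:\alpha<\lambda\}$ a family of Tychonoff spaces and $\{\lambda_\alpha:\alpha<\lambda\}$ a collection of cardinals such that for any $\alpha<\lambda$ and $\beta<\lambda$: (1) $\mathsf{C}(C_p(X_\alpha))=\{\kappa:\kappa\text{ is an infinite cardinal and }\mathrm{cf}(\kappa)>\lambda_\alpha\}$, and (2) if $\lambda_\alpha=\lambda_\beta$, then $C_p(X_\alpha)$ is homeomorphic to $C_p(X_\beta)$. If $\mathrm{cf}(\kappa)$ is not weakly inaccessible for every $\kappa\in\bigcap_{\alpha<\lambda}\mathsf{C}(C_p(X_\alpha))$, then $$\mathsf{C}\Big(C_p\Big(\bigoplus_{\alpha<\lambda}X_\alpha\Big)\Big)=\bigcap_{\alpha<\lambda}\mathsf{C}(C_p(X_\alpha)).$$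
   Context: $\bigoplus$ denotes the topological sum (disjoint union). For a Tychonoff space $X$, $C_p(X)$ is the set of continuous functions $X\to\mathbb{R}$ with the topology of pointwise convergence (the subspace topology from $\mathbb{R}^X$). An infinite cardinal $\kappa$ is a caliber for a space $Z$ if for every set $I$ with $|I|=\kappa$ and every indexed family $\{U_\alpha:\alpha\in I\}$ of nonempty open subsets of $Z$ there is $J\subseteq I$ with $|J|=\kappa$ and $\bigcap_{\alpha\in J}U_\alpha\neq\emptyset$. $\mathsf{C}(Z)$ denotes the class of all infinite cardinals that are calibers for $Z$. A cardinal is weakly inaccessible if it is an uncountable regular limit cardinal. *)

(* Defs.v *)
From mathcomp Require Import all_boot all_order all_algebra.
From mathcomp Require Import all_classical wochoice all_reals all_analysis.
Import numFieldNormedType.Exports.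

Set Implicit Arguments.
Unset Strict Implicit.
Unset Printing Implicit Defensive.

Local Open Scope classical_set_scope.
Local Open Scope card_scope.

Reserved Notation "A '#<' B" (at level 79, format "A  '#<'  B").

(* A cardinal is represented by any type of that cardinality: two cardinals
   K and M are equal when [set: K] #= [set: M].  Naming the sort makes all the
   cardinals below range over one and the same universe. *)
Definition cardinal := Type.

Definition card_lt (T U : Type) (A : set T) (B : set U) : bool :=
  (A #<= B) && ~~ (B #<= A).
Notation "A '#<' B" := (card_lt A B) : card_scope.

Definition infinite_card (K : cardinal) : Prop := infinite_set [set: K].

(* R orders K like the initial ordinal of cardinality |K|. *)
Definition initial_order (K : cardinal) (R : rel K) : Prop :=
  well_order R /\ forall x, [set y | R y x /\ y <> x] #< [set: K].

Definition cofinal (K : cardinal) (R : rel K) (C : set K) : Prop :=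
  forall x, exists2 y, C y & R x y.

Definition least_cofinal (K : cardinal) (C : set K) : Prop :=
  exists R : rel K, [/\ initial_order R, cofinal R C &
    forall D : set K, cofinal R D -> C #<= D].

(* cf(K), as a subset of K of that cardinality.  Initial orders on K are
   pairwise isomorphic, so the cardinality does not depend on the choice; the
   default set0 is never used (cfP). *)
Definition cf (K : cardinal) : set K := xget set0 (@least_cofinal K).
Arguments cf : clear implicits.

Definition regular_card (K : cardinal) : Prop :=
  infinite_card K /\ cf K #= [set: K].

Definition successor_card (M K : cardinal) : Prop :=
  [set: M] #< [set: K] /\
  forall N : cardinal, [set: M] #< [set: N] -> [set: K] #<= [set: N].

Definition limit_card (K : cardinal) : Prop :=
  [set: K] !=set0 /\ ~ exists M : cardinal, successor_card M K.

Definition weakly_inaccessible (K : cardinal) : Prop :=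
  [/\ ~ countable [set: K], regular_card K & limit_card K].

Definition caliber (Z : topologicalType) (K : cardinal) : Prop :=
  forall (I : cardinal) (U : I -> set Z),
    [set: I] #= [set: K] ->
    (forall i, open (U i)) -> (forall i, U i !=set0) ->
    exists J : set I, J #= [set: K] /\ \bigcap_(i in J) U i !=set0.

(* Membership of K in the class C(Z). *)
Definition in_calibers (Z : topologicalType) (K : cardinal) : Prop :=
  infinite_card K /\ caliber Z K.

Definition tychonoff_space (X : topologicalType) : Prop :=
  hausdorff_space X /\ completely_regular_space X.

(* {ptws X -> R} is R^X with the product topology and the type of the elements
   of a set carries the subspace topology. *)
Definition Cp (R : realType) (X : topologicalType) : topologicalType :=
  [set f : {ptws X -> R} | continuous (f : X -> R)].

Definition homeomorphic (X Y : topologicalType) : Prop :=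
  exists (f : X -> Y) (g : Y -> X),
    [/\ continuous f, continuous g, cancel f g & cancel g f].

Lemma least_card (T : Type) (F : set (set T)) :
  F !=set0 -> exists2 A, F A & forall B, F B -> A #<= B.
Proof.
move=> [F0 FF0].
pose P (S : set (set T -> T)) :=
  (forall f A, S f -> F A -> A (f A)) /\
  (forall f g A, S f -> S g -> F A -> f A = g A -> f = g).
have [G GP Gtot|S [[Sin Sinj] Smax]] := @Zorn_bigcup _ P.
  split=> [f A [X GX Xf] FA|f g A [X GX Xf] [Y GY Yg] FA].
    exact: ((GP X GX).1 f A Xf FA).
  have [XY|YX] := Gtot _ _ GX GY.
    exact: ((GP Y GY).2 f g A (XY _ Xf) Yg FA).
  exact: ((GP X GX).2 f g A Xf (YX _ Yg) FA).
have [[A FA AS]|nA] :=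
    pselect (exists2 A, F A & forall a, A a -> exists2 f, S f & f A = a).
  exists A => // B FB.
  have /choice[h hP] : forall a : T, exists f, A a -> S f /\ f A = a.
    move=> a; have [Aa|nAa] := pselect (A a); last by exists (fun=> a).
    by have [f Sf fA] := AS a Aa; exists f.
  have hB : set_fun A B (fun a => h a B).
    by move=> a Aa; apply: Sin FB; exact: (hP a Aa).1.
  have hi : set_inj A (fun a => h a B).
    move=> a b /set_mem Aa /set_mem Ab hab.
    have [Sa <-] := hP a Aa; have [Sb <-] := hP b Ab.
    by rewrite (Sinj _ _ B Sa Sb FB hab).
  have [f] : $|{injfun A >-> B}| by apply/injfunPex; exists (fun a => h a B).
  exact: inj_card_le f.
exfalso.
have /choice[h hP] : forall A : set T, exists a,
    F A -> A a /\ forall f, S f -> f A <> a.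
  move=> A; have [FA|nFA] := pselect (F A); last first.
    have [t _] : F0 !=set0; last by exists t.
    apply/set0P/eqP => F00; apply: nA; exists F0 => // a.
    by rewrite F00.
  have [a [Aa aS]] : exists a, A a /\ forall f, S f -> f A <> a.
    apply: contrapT => /forallNP H; apply: nA; exists A => // a Aa.
    apply: contrapT => nf; apply: (H a); split=> // f Sf fa.
    by apply: nf; exists f.
  by exists a.
apply: (Smax (S `|` [set h])).
  split; first exact: subsetUl.
  by move=> /(_ h (or_intror erefl)) Sh; exact: ((hP F0 FF0).2 h Sh erefl).
split=> [f A [Sf|->] FA|f g A [Sf|->] [Sg|->] FA //].
- exact: (Sin f A Sf FA).
- exact: (hP A FA).1.
- exact: (Sinj f g A Sf Sg FA).
- by move=> fh; case: ((hP A FA).2 f Sf fh).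
- by move=> hg; case: ((hP A FA).2 g Sg (esym hg)).
Qed.

Lemma initial_order_ex (K : cardinal) : exists R : rel K, initial_order R.
Proof.
elim/Peq: K => K.
have [R woR] := well_ordering_principle K.
pose seg x := [set y | R y x /\ y <> x].
have segT x : seg x #<= [set: K] by apply: subset_card_le.
have [[x0 nx0]|all_lt] := pselect (exists x, ~ (seg x #< [set: K])); last first.
  exists R; split=> // x; apply: contrapT => nx; apply: all_lt; by exists x.
have [x [[/asboolP xP xmin] _]] :
    exists! z, minimum_of R [pred x | `[< ~ (seg x #< [set: K]) >]] z.
  by apply: woR; exists x0; apply/asboolP.
have Tx : [set: K] #<= seg x.
  by apply: contrapT => /negP nT; apply: xP; rewrite /card_lt segT.
have [f fseg finj] : exists2 f : K -> K, (forall y, seg x (f y)) & injective f.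
  have /card_leP[g] := Tx.
  pose i (y : K) : [set: K] := SigSub (mem_set (I : [set: K] y)).
  pose j (y : K) : [set: [set: K]] := SigSub (mem_set (I : [set: [set: K]] (i y))).
  exists (fun y => val (g (i y))) => [y|y z /val_inj gyz].
    exact: set_mem (valP (g (i y))).
  have := @inj _ _ _ g (i y) (i z) (mem_set I) (mem_set I) gyz.
  by move=> /(congr1 val).
have ltR y z : R y z -> R z y -> y = z.
  move=> yz zy.
  have [|w [_ wu]] := woR (pred2 y z); first by exists y; rewrite !inE eqxx.
  have Rr u : R u u.
    have [|v [[/eqP-> /(_ u) H] _]] := woR (pred1 u).
      by exists u; rewrite inE.
    by apply: H; rewrite inE.
  by rewrite -(wu y) ?(wu z) //; split; rewrite ?inE ?eqxx ?orbT // => v;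
    rewrite !inE => /orP[]/eqP->.
exists (fun y z => R (f y) (f z)); split=> [A [a Aa]|y].
  have [|w [[/asboolP[z Az zw] wmin] wu]] :=
      woR [pred u | `[< exists2 z, z \in A & f z = u >]].
    by exists (f a); apply/asboolP; exists a.
  exists z; split; first split=> // t At; rewrite ?zw.
    by apply: wmin; apply/asboolP; exists t.
  move=> t [At tmin]; apply: finj; rewrite zw; apply: wu; split.
    by apply/asboolP; exists t.
  by move=> v /asboolP[s As <-]; exact: tmin.
have lt_fy : seg (f y) #< [set: K].
  apply: contrapT => nfy; have [Rfx] := fseg y; apply; apply: ltR => //.
  by apply: xmin; apply/asboolP.
rewrite /card_lt subset_card_le //=; apply/negP => TS.
have := lt_fy; rewrite /card_lt => /andP[_] /negP; apply.
apply: card_le_trans TS _.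
have [g] : $|{injfun [set z | R (f z) (f y) /\ z <> y] >-> seg (f y)}|.
  apply/injfunPex; exists f; last by move=> ? ? _ _ /finj.
  by move=> z [Rz zy]; split=> // /finj.
exact: inj_card_le g.
Qed.

Lemma cfP (K : cardinal) : least_cofinal (cf K).
Proof.
rewrite /cf; apply: xgetPex; have [R iR] := initial_order_ex K.
have [|C cC Cmin] := @least_card K [set C | cofinal R C]; last first.
  by exists C, R.
exists setT => x; exists x => //.
have [|v [[/asboolP-> /(_ x) H] _]] := iR.1 [pred y | `[< y = x >]].
  by exists x; apply/asboolP.
by apply: H; apply/asboolP.
Qed.

(* Main.v *)
Require Import Defs.
From mathcomp Require Import all_boot all_order all_algebra lra.
From mathcomp Require Import all_classical wochoice all_reals all_analysis.
Import numFieldNormedType.Exports.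

(** Restriction to the summands identifies C_p of a topological sum with the
    product of the spaces C_p(X_a).  A caliber of C_p of the sum is therefore a
    caliber of every C_p(X_a), as calibers pass to continuous images.  For the
    converse, let K be a caliber of every C_p(X_a), so that lam a < cf K for all
    a.

    If cf K is countable, then lam a < cf K <= cf(aleph_0) makes aleph_0 a
    caliber of C_p(X_a).  As the evaluation at a point of X_a maps onto the real
    line, where an infinite family of disjoint intervals exists, X_a is empty
    ([caliber_nat_Cp_empty]); then C_p of the sum has a single point.

    If cf K is uncountable, it is regular ([cf_idem]) and not weakly
    inaccessible, hence the successor of some cardinal M.  All the lam a are at
    most M, and there are at most |M| < cf K cardinals up to M
    ([classify_cardinals_lt_cf]), so by hypothesis the factors C_p(X_a) have
    fewer than cf K homeomorphism types.  It remains to show that such a product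
    has caliber K ([caliber_prod_topology]).  Shrink the K given open sets to
    boxes.  The pigeonhole principle for fewer than cf K classes
    ([cf_pigeonhole]) holds for singular K too, and lets one assume that all the
    boxes restrict the same number n of coordinates.

    For n = 1, a second use of the pigeonhole principle makes all the restricted
    factors homeomorphic to a single one; K being a caliber of it, one
    point lies in K of the sets, and copying this point to all the coordinates
    of that type solves the problem, whichever coordinates occur
    ([caliber_coordinate]).  For larger n, treat the first coordinate and the
    others separately, and combine the two partial solutions.  This fails only
    when the first coordinate of one box is another coordinate of a second box.
    Such collisions are avoided by [disjoint_images]: if f and g are maps on K
    with f i <> g i for all i, then f(J) and g(J) are disjoint for some J of
    size K.  The proof orders the values, colours them recursively with two
    colours so that each value v differs in colour from at least half of the
    smaller values linked to it, and keeps the indices whose two values have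
    different colours.  This takes the place of the Delta-system lemma and works
    uniformly for regular and singular K.

    The cardinal arithmetic rests on one principle, [greedy_card_le]: choosing
    new elements by well-founded recursion injects D into A as long as no
    segment below a point of D exhausts A. *)

Set Implicit Arguments.
Unset Strict Implicit.
Unset Printing Implicit Defensive.

Import Order.TTheory GRing.Theory Num.Theory.
Local Open Scope classical_set_scope.
Local Open Scope card_scope.

(** * Comparison of cardinals *)

Lemma card_le_inj T U (A : set T) (B : set U) (f : T -> U) :
  (forall x, A x -> B (f x)) ->
  (forall x y, A x -> A y -> f x = f y -> x = y) -> A #<= B.
Proof.
move=> fAB finj.
have [g] : $|{injfun A >-> B}|.
  by apply/injfunPex; exists f => // x y /set_mem Ax /set_mem Ay; exact: finj.
exact: inj_card_le g.
Qed.

Lemma card_le_fun T U (A : set T) (B : set U) (u0 : U) : A #<= B ->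
  exists f : T -> U, (forall x, A x -> B (f x)) /\
    (forall x y, A x -> A y -> f x = f y -> x = y).
Proof.
move=> /card_leP[g].
pose i x (Ax : A x) : A := SigSub (mem_set Ax).
exists (fun x => if pselect (A x) is left Ax then val (g (i x Ax)) else u0).
split=> [x Ax|x y Ax Ay].
  by case: pselect => // h; exact: set_mem (valP _).
case: pselect => // hx; case: pselect => // hy /val_inj gxy.
have := @inj _ _ _ g (i x hx) (i y hy) (mem_set I) (mem_set I) gxy.
by move=> /(congr1 val).
Qed.

Lemma card_le_funT T U (B : set U) : [set: T] #<= B ->
  exists f : T -> U, (forall x, B (f x)) /\ injective f.
Proof.
have [[t _]|nT _] := pselect (exists t : T, True).
  move=> TB; have [u Bu] : B !=set0.
    apply/set0P/eqP => B0; move: TB; rewrite B0 card_le0 => /eqP T0.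
    by have : [set: T] t by []; rewrite T0.
  have [f [fB fi]] := card_le_fun u TB.
  by exists f; split=> [x|x y]; [exact: fB | exact: fi].
exists (fun t => False_rect _ (nT (ex_intro _ t I))).
by split=> x; case: (nT _); exists x.
Qed.

(** Both sets embed in T + U, and the family of the two images has a member of
    least cardinality. *)
Lemma card_le_total T U (A : set T) (B : set U) : A #<= B \/ B #<= A.
Proof.
pose F : set (set (T + U)) := [set [set inl x | x in A]; [set inr x | x in B]].
have eA : [set (inl x : T + U) | x in A] #= A.
  by apply: inj_card_eq => x y _ _ [].
have eB : [set (inr x : T + U) | x in B] #= B.
  by apply: inj_card_eq => x y _ _ [].
have [|C FC Cmin] := @least_card _ F; first by eexists; left.
have lA := Cmin _ (or_introl erefl); have lB := Cmin _ (or_intror erefl).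
case: FC lA lB => ->.
  by move=> _ AB; left; move: AB; rewrite (card_le_eql eA) (card_le_eqr eB).
by move=> BA _; right; move: BA; rewrite (card_le_eql eB) (card_le_eqr eA).
Qed.

Lemma card_ltNge T U (A : set T) (B : set U) : A #< B <-> ~ (B #<= A).
Proof.
split=> [/andP[_ /negP]//|nBA]; apply/andP; split; last exact/negP.
by case: (card_le_total A B).
Qed.

Lemma card_leNgt T U (A : set T) (B : set U) : ~ (A #< B) <-> B #<= A.
Proof. by rewrite card_ltNge; split=> [/contrapT|?]. Qed.

Lemma card_le_lt_trans T U V (A : set T) (B : set U) (C : set V) :
  A #<= B -> B #< C -> A #< C.
Proof. by rewrite !card_ltNge => AB + CA; apply; exact: card_le_trans CA AB. Qed.

Lemma card_lt_le_trans T U V (A : set T) (B : set U) (C : set V) :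
  A #< B -> B #<= C -> A #< C.
Proof. by rewrite !card_ltNge => + BC CA; apply; exact: card_le_trans BC CA. Qed.

Section strict_well_order.
Context {T : Type} (R : rel T) (woR : well_order R).

Lemma wo_refl x : R x x.
Proof.
have [|v [[/asboolP-> /(_ x) H] _]] := woR (A := [pred y | `[< y = x >]]).
  by exists x; apply/asboolP.
by apply: H; apply/asboolP.
Qed.

Lemma wo_min (P : set T) : P !=set0 -> exists2 x, P x & forall y, P y -> R x y.
Proof.
move=> [x Px].
have [|v [[/asboolP Pv vmin] _]] := woR (A := [pred y | `[< P y >]]).
  by exists x; apply/asboolP.
by exists v => // y Py; apply: vmin; apply/asboolP.
Qed.

Lemma wo_total x y : R x y \/ R y x.
Proof.
have [|z [->|->] zm] := @wo_min [set x; y]; first by exists x; left.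
  by left; apply: zm; right.
by right; apply: zm; left.
Qed.

Lemma wo_anti x y : R x y -> R y x -> x = y.
Proof.
move=> xy yx; have [|w [_ wu]] := woR (A := [pred z | `[< z = x \/ z = y >]]).
  by exists x; apply/asboolP; left.
have H z : z = x \/ z = y -> minimum_of R [pred z | `[< z = x \/ z = y >]] z.
  move=> zxy; split; first exact/asboolP.
  by move=> t /asboolP; case: zxy => -> [] -> //; exact: wo_refl.
by rewrite -(wu x (H _ _)) ?(wu y (H _ _)); auto.
Qed.

Lemma wo_trans y x z : R x y -> R y z -> R x z.
Proof.
move=> xy yz; have [|t [[->|->]|->] tm] := @wo_min [set x; y; z].
- by exists x; left; left.
- by apply: tm; right.
- have -> : x = y by apply: wo_anti => //; apply: tm; left; left.
  by [].
- have zy : z = y by apply: wo_anti => //; apply: tm; left; right.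
  by rewrite zy.
Qed.

Lemma wo_ltVge x y : (R x y /\ x <> y) \/ R y x.
Proof.
have [->|xy] := pselect (x = y); first by right; exact: wo_refl.
by case: (wo_total x y); [left|right].
Qed.

Lemma wo_wf : well_founded (fun y x => R y x /\ y <> x).
Proof.
move=> x; apply: contrapT => nx.
have [|y ny ym] := @wo_min [set x | ~ Acc (fun y x => R y x /\ y <> x) x].
  by exists x.
apply: ny; constructor => z [zy nzy]; apply: contrapT => /ym yz.
by apply: nzy; exact: wo_anti.
Qed.

Lemma wo_tri x y : x <> y -> (R x y /\ x <> y) \/ (R y x /\ y <> x).
Proof. by move=> xy; case: (wo_total x y) => ?; [left|right; split=> // /esym]. Qed.

End strict_well_order.

Lemma wf_rec T U (lt : T -> T -> Prop)
    (G : forall x, (forall y, lt y x -> U) -> U) :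
  well_founded lt -> exists h : T -> U, forall x, h x = G x (fun y _ => h y).
Proof.
move=> wf; exists (Fix wf (fun=> U) G) => x; rewrite Fix_eq // => {}x f g fg.
congr G; apply: functional_extensionality_dep => y; apply: funext => p.
by rewrite fg.
Qed.

(** Choose for each x, by recursion, a point of A not yet taken below x: the
    hypothesis says that the points taken so far never fill A.  Two
    points of D get different values because one of them is below the other. *)
Lemma greedy_card_le T U (lt : T -> T -> Prop) (D : set T) (A : set U) :
  well_founded lt -> (forall x y, x <> y -> lt x y \/ lt y x) ->
  (forall y, D y -> ~ (A #<= [set z | lt z y])) -> D #<= A.
Proof.
move=> wf tri small.
have [->|/set0P[d0 Dd0]] := eqVneq D set0; first exact: card_ge0.
have [u0 Au0] : A !=set0.
  by apply/set0P/eqP => A0; apply: (small _ Dd0); rewrite A0 card_ge0.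
have [h hE] := wf_rec (fun x (h : forall y, lt y x -> U) =>
  xget (u0 : {classic U})
    [set a | A a /\ forall z (p : lt z x), h z p <> a]) wf.
have hP x : D x -> A (h x) /\ forall z, lt z x -> h z <> h x.
  move=> Dx; rewrite hE.
  apply: (xgetPex (u0 : {classic U}) (P := [set a | A a /\ _])).
  apply: contrapT => /forallNP nP; apply: (small _ Dx).
  apply: card_le_trans (card_image_le h [set z | lt z x]).
  apply: subset_card_le => a Aa; apply: contrapT => na; apply: (nP a).
  by split=> // z zx hza; apply: na; exists z.
apply: (@card_le_inj _ _ _ _ h) => [x /hP[]//|x y Dx Dy hxy].
apply: contrapT => /tri[xy|yx].
  exact: (hP _ Dy).2 _ xy hxy.
exact: (hP _ Dx).2 _ yx (esym hxy).
Qed.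

(** * Infinite squares *)

Lemma card_le_infinite T U (A : set T) (B : set U) :
  A #<= B -> infinite_set A -> infinite_set B.
Proof. by move=> AB /infiniteP nA; apply/infiniteP; exact: card_le_trans AB. Qed.

(** Hilbert's hotel: shift a sequence j of distinct points of A with j 0 = x. *)
Lemma infinite_card_le_setD1 T (A : set T) x : infinite_set A -> A #<= A `\ x.
Proof.
move=> Ainf; have [Ax|nAx] := pselect (A x); last first.
  by apply: subset_card_le => y Ay; split=> // yx; apply: nAx; rewrite -yx.
have /infiniteP/card_le_funT[i [iA iinj]] : infinite_set (A `\ x).
  exact: infinite_setD.
pose j n := if n is m.+1 then i m else x.
have jA n : A (j n) by case: n => //= m; have [] := iA m.
have jinj : injective j.
  by move=> [|m] [|n] //= => [h|h|/iinj->//];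
    [case: (iA n) => _ []|case: (iA m) => _ []].
pose h y := if pselect (exists n, y = j n) is left e then j (projT1 (cid e)).+1
            else y.
have hj n : h (j n) = j n.+1.
  rewrite /h; case: pselect => [e|[]]; last by exists n.
  by case: cid => m /= /jinj ->.
have hN y : ~ (exists n, y = j n) -> h y = y by rewrite /h; case: pselect.
apply: (@card_le_inj _ _ _ _ h) => [y Ay|y z Ay Az].
  have [[n ->]|nj] := pselect (exists n, y = j n); first by rewrite hj; exact: iA.
  by rewrite hN //; split=> // yx; apply: nj; exists 0%N.
have [[n ->]|nj] := pselect (exists n, y = j n);
  have [[m ->]|nk] := pselect (exists n, z = j n); rewrite ?hj ?hN //.
- by move=> /jinj[->].
- by move=> jz; case: nk; exists n.+1.
- by move=> jz; case: nj; exists m.+1.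
Qed.

(** A last element x would leave a segment K minus x, of the cardinality of
    K. *)
Lemma initial_order_nomax (K : cardinal) (R : rel K) x : infinite_card K ->
  initial_order R -> exists y, R x y /\ x <> y.
Proof.
move=> Kinf [woR seg]; apply: contrapT => /forallNP xmax.
have := seg x; rewrite card_ltNge; apply.
apply: card_le_trans (infinite_card_le_setD1 x Kinf) _.
apply: subset_card_le => y [_ yx]; split=> //.
by have [[xy nxy]|//] := wo_ltVge woR x y; case: (xmax y).
Qed.

Lemma initial_order_le_lt (K : cardinal) (R : rel K) x : infinite_card K ->
  initial_order R -> [set y | R y x] #< [set: K].
Proof.
move=> Kinf iR; have [z [xz nxz]] := initial_order_nomax x Kinf iR.
apply: card_le_lt_trans (iR.2 z); apply: subset_card_le => y yx.
split; first exact: (wo_trans iR.1) yx xz.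
by move=> yz; apply: nxz; apply: (wo_anti iR.1) => //; rewrite -yz.
Qed.

Section goedel_order.
Context {T : Type} (R : rel T) (woR : well_order R).

Let mx (p : T * T) := if R p.1 p.2 then p.2 else p.1.
Let lt x y := R x y /\ x <> y.

(** Goedel's order on pairs: first by the larger entry, then
    lexicographically. *)
Definition goedel_lt (p q : T * T) :=
  lt (mx p) (mx q) \/ (mx p = mx q /\
    (lt p.1 q.1 \/ (p.1 = q.1 /\ lt p.2 q.2))).

Lemma goedel_wf : well_founded goedel_lt.
Proof.
have wf := wo_wf woR.
suff H a b c p : mx p = a -> p.1 = b -> p.2 = c -> Acc goedel_lt p.
  by move=> p; exact: H.
elim/(well_founded_ind wf): a b c p => a IHa b.
elim/(well_founded_ind wf): b => b IHb c.
elim/(well_founded_ind wf): c => c IHc p pa pb pc.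
constructor => q [|[qp [|[q1 q2]]]].
- by rewrite pa => qa; exact: IHa qa _ _ _ _ _ _.
- by rewrite pb => qb; apply: IHb qb _ _ _ _ _; rewrite ?qp.
- by rewrite pc in q2; apply: IHc q2 _ _ _ _; rewrite ?qp ?q1.
Qed.

Lemma goedel_tri p q : p <> q -> goedel_lt p q \/ goedel_lt q p.
Proof.
move=> pq; rewrite /goedel_lt.
have [e0|/(wo_tri woR)] := pselect (mx p = mx q); last by rewrite /lt; tauto.
have [e1|/(wo_tri woR)] := pselect (p.1 = q.1); last first.
  by rewrite /lt e0; tauto.
have /(wo_tri woR) : p.2 <> q.2.
  by move=> e2; apply: pq; case: p q e0 e1 e2 => ? ? [? ?] /= _ -> ->.
by rewrite /lt e0 e1; tauto.
Qed.

(** What the larger entry is for: the pairs below p lie in the square of an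
    initial segment. *)
Lemma goedel_sub p : exists z, forall q, goedel_lt q p -> R q.1 z /\ R q.2 z.
Proof.
exists (mx p) => q qp; have : R (mx q) (mx p).
  by case: qp => [[]//|[-> _]]; exact: wo_refl.
have : R q.1 (mx q) /\ R q.2 (mx q).
  rewrite /mx; case: ifP => [q12|/negP q12]; split=> //.
  - exact: wo_refl.
  - exact: wo_refl.
  - by case: (wo_total woR q.1 q.2).
move=> [h1 h2] h.
by split; [exact: (wo_trans woR) h1 h|exact: (wo_trans woR) h2 h].
Qed.

End goedel_order.

(** Hessenberg's theorem.  In a counterexample of least cardinality, a segment
    of Goedel's order is contained in the square of a smaller set, hence is
    itself smaller, so the greedy principle injects the square into the set. *)
Lemma infinite_square_card_le (K : cardinal) : infinite_card K ->
  [set: K * K] #<= [set: K].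
Proof.
(* the case of a cardinal N below which the theorem holds *)
have step (N : cardinal) : infinite_card N ->
    (forall C : set N, infinite_set C -> C #< [set: N] -> C `*` C #<= C) ->
    [set: N * N] #<= [set: N].
  move=> Ninf small; have [R iR] := initial_order_ex N.
  apply: (greedy_card_le (goedel_wf iR.1) (goedel_tri iR.1)) => p _ Np.
  have [z zP] := goedel_sub iR.1 p.
  pose C := [set x | R x z].
  have CN : C #< [set: N] by exact: initial_order_le_lt.
  have NCC : [set: N] #<= C `*` C.
    by apply: card_le_trans Np _; apply: subset_card_le => q /zP.
  have Cinf : infinite_set C.
    by move=> Cfin; apply: (card_le_infinite NCC) => //; exact: finite_setX.
  move: (CN); rewrite card_ltNge; apply; apply: card_le_trans NCC _; exact: small.
move=> Kinf; apply: contrapT => nK.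
have [|B [Binf nB] Bmin] := @least_card K
    [set B | infinite_set B /\ ~ (B `*` B #<= B)].
  by exists setT; split=> // h; apply: nK; rewrite -setXTT.
have eB (C : set B) : val @` C #= C by apply: inj_card_eq => ? ? _ _ /val_inj.
apply: nB; have : [set: B * B] #<= [set: B].
  apply: step => [|C Cinf].
    by apply: card_le_infinite Binf; rewrite (card_le_eqr (card_setT B)).
  rewrite card_ltNge => BC; apply: contrapT => nC; apply: BC.
  rewrite (card_le_eql (card_setT B)) -(card_le_eqr (eB C)).
  apply: Bmin; split.
    by apply: card_le_infinite Cinf; rewrite (card_le_eqr (eB C)).
  rewrite (card_le_eqr (eB C)) => h; apply: nC; apply: card_le_trans h.
  apply: (@card_le_inj _ _ _ _ (fun p => (val p.1, val p.2))).
    by move=> [x y] [Cx Cy]; split; [exists x|exists y].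
  by move=> [x y] [x' y'] _ _ /= [/val_inj-> /val_inj->].
rewrite (card_le_eqr (card_setT B)); apply: card_le_trans.
have [b0 Bb0] := infinite_setN0 Binf.
pose i x : B := if pselect (B x) is left h then SigSub (mem_set h)
                else SigSub (mem_set Bb0).
have iK x : B x -> val (i x) = x by rewrite /i; case: pselect.
apply: (@card_le_inj _ _ _ _ (fun p => (i p.1, i p.2))) => //.
move=> [x y] [x' y'] [/= Bx By] [/= Bx' By'] [].
by move=> /(congr1 val) + /(congr1 val); rewrite !iK // => -> ->.
Qed.

Lemma card_setX_le T U V W (A : set T) (B : set U) (C : set V) (D : set W) :
  A #<= C -> B #<= D -> A `*` B #<= C `*` D.
Proof.
move=> AC BD.
have [->|/set0P[[a b] [/= Aa Bb]]] := eqVneq (A `*` B) set0; first exact: card_ge0.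
have [c0 _] : C !=set0.
  apply/set0P/eqP => C0; move: AC; rewrite C0 card_le0 => /eqP A0.
  by rewrite A0 in Aa.
have [d0 _] : D !=set0.
  apply/set0P/eqP => D0; move: BD; rewrite D0 card_le0 => /eqP B0.
  by rewrite B0 in Bb.
have [f [fC fi]] := card_le_fun c0 AC; have [g [gD gi]] := card_le_fun d0 BD.
apply: (@card_le_inj _ _ _ _ (fun p => (f p.1, g p.2))).
  by move=> [x y] [/fC ? /gD ?].
by move=> [x y] [x' y'] [/= ? ?] [/= ? ?] [/fi-> // /gi->].
Qed.

Lemma card_setX_lt T U (A : set T) (B : set U) (K : cardinal) :
  infinite_card K -> A #< [set: K] -> B #< [set: K] -> A `*` B #< [set: K].
Proof.
move=> Kinf.
have sq V (C : set V) : C #< [set: K] -> C `*` C #< [set: K].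
  move=> CK; have [Cfin|Cinf] := pselect (finite_set C).
    by apply/card_ltNge => KCC; apply: (card_le_infinite KCC) => //; exact: finite_setX.
  apply: card_le_lt_trans CK.
  have e : [set: C] #= C := card_setT C.
  have : [set: C * C] #<= [set: C].
    apply: infinite_square_card_le; apply: card_le_infinite Cinf.
    by rewrite (card_le_eqr e).
  rewrite (card_le_eqr e) -setXTT; apply: card_le_trans.
  by apply: card_setX_le; rewrite (card_le_eqr e).
move=> AK BK; case: (card_le_total A B) => AB.
  by apply: card_le_lt_trans (sq _ _ BK); apply: card_setX_le.
by apply: card_le_lt_trans (sq _ _ AK); apply: card_setX_le.
Qed.

(** * Cofinality *)

Lemma finite_card_lt T U (A : set T) (B : set U) :
  finite_set A -> infinite_set B -> A #< B.
Proof. by move=> Af Bi; apply/card_ltNge => /card_le_infinite /(_ Bi). Qed.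

Lemma cf_unbounded (K : cardinal) : exists R : rel K,
  [/\ initial_order R, cofinal R (cf K) &
    forall D : set K, D #< cf K -> exists x, forall y, D y -> R y x /\ y <> x].
Proof.
have [R [iR cR cmin]] := cfP K; exists R; split=> // D /card_ltNge nD.
apply: contrapT => /forallNP nb; apply: nD; apply: cmin => x.
apply: contrapT => nx; apply: (nb x) => y Dy.
by have [//|xy] := wo_ltVge iR.1 y x; case: nx; exists y.
Qed.

(** A cofinal set has no last element, as an infinite initial order has none, so
    it contains a strictly increasing sequence. *)
Lemma infinite_cf (K : cardinal) : infinite_card K -> infinite_set (cf K).
Proof.
move=> Kinf; have [R [iR cR _]] := cf_unbounded K.
have step x : exists y, cf K y /\ (R x y /\ x <> y).
  have [z [xz nxz]] := initial_order_nomax x Kinf iR.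
  have [y Cy zy] := cR z; exists y; split=> //.
  split; first exact: (wo_trans iR.1 xz zy).
  by move=> xy; apply: nxz; apply: (wo_anti iR.1) => //; rewrite xy.
have /choice[s sP] := step.
have [x0 _] := infinite_setN0 Kinf.
pose u n := iter n.+1 s x0.
have ult m n : R (u m) (u (m + n.+1)%N) /\ u m <> u (m + n.+1)%N.
  elim: n => [|n [IH nIH]]; first by rewrite addn1; exact: (sP _).2.
  rewrite addnS; have [h nh] := (sP (u (m + n.+1)%N)).2.
  split; first exact: (wo_trans iR.1 IH h).
  by move=> e; apply: nh; apply: (wo_anti iR.1) => //; rewrite -[s _]e.
apply/infiniteP; apply: (@card_le_inj _ _ _ _ u) => [n _|m n _ _ umn].
  exact: (sP _).1.
have H i j : (i < j)%N -> u i <> u j.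
  by move=> ij; rewrite -(subnKC ij) addSnnS; exact: (ult _ _).2.
by case: (ltngtP m n) => // /H[]; rewrite umn.
Qed.

Lemma card_lt_segment (K : cardinal) (R : rel K) T (A : set T) :
  well_order R -> A #< [set: K] -> exists x, A #<= [set y | R y x /\ y <> x].
Proof.
move=> woR /card_ltNge nKA; apply: contrapT => /forallNP h; apply: nKA.
by apply: (greedy_card_le (wo_wf woR) (wo_tri woR)) => y _; exact: h.
Qed.

(** If all the fibres were smaller than K, each would embed in a segment of an
    initial order on K.  Fewer than cf K segments have a common bound z, so K
    would embed in S times the segment below z, a product of two sets smaller
    than K.  In particular K may be singular. *)
Lemma cf_pigeonhole (K : cardinal) T (A : set T) S (p : T -> S) :
  infinite_card K -> [set: K] #<= A -> [set: S] #< cf K ->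
  exists s, [set: K] #<= A `&` p @^-1` [set s].
Proof.
move=> Kinf /card_le_funT[i [iA iinj]] Slt.
suff [s Ks] : exists s, [set: K] #<= (p \o i) @^-1` [set s].
  exists s; apply: card_le_trans Ks _.
  by apply: (@card_le_inj _ _ _ _ i) => [x|x y _ _ /iinj//]; split.
apply: contrapT => /forallNP ns.
have [R [iR _ bnd]] := cf_unbounded K.
have /choice[x xP] : forall s, exists x,
    (p \o i) @^-1` [set s] #<= [set y | R y x /\ y <> x].
  by move=> s; apply: (card_lt_segment iR.1); apply/card_ltNge; exact: ns.
have [|z zP] := bnd (range x).
  by apply: card_le_lt_trans Slt; exact: card_image_le.
have /choice[f fP] : forall s, exists f : K -> K,
    (forall k, p (i k) = s -> R (f k) z /\ f k <> z) /\
    (forall k l, p (i k) = s -> p (i l) = s -> f k = f l -> k = l).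
  move=> s; have h : (p \o i) @^-1` [set s] #<= [set y | R y z /\ y <> z].
    apply: card_le_trans (xP s) _; apply: subset_card_le => y [yx _].
    have [xz nxz] : R (x s) z /\ x s <> z by apply: zP; exists s.
    split; first exact: (wo_trans iR.1 yx xz).
    by move=> yz; apply: nxz; apply: (wo_anti iR.1) => //; rewrite -yz.
  exact: card_le_fun z h.
have /card_ltNge : [set: S] `*` [set y | R y z /\ y <> z] #< [set: K].
  apply: card_setX_lt (iR.2 z) => //.
  by apply: card_lt_le_trans Slt _; exact: card_leT.
apply; apply: (@card_le_inj _ _ _ _ (fun k => (p (i k), f (p (i k)) k))).
  by move=> k _; split=> //; exact: (fP (p (i k))).1.
by move=> k l _ _ [e]; rewrite -e; apply: (fP (p (i k))).2.
Qed.

Lemma infinite_pigeonhole2 (K : cardinal) T (A B : set T) : infinite_card K ->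
  [set: K] #<= A `|` B -> [set: K] #<= A \/ [set: K] #<= B.
Proof.
move=> Kinf KAB.
have [|b Kb] := cf_pigeonhole (fun x => `[< A x >]) Kinf KAB.
  by apply: finite_card_lt; [exact: finite_finset|exact: infinite_cf].
case: b Kb => Kb; [left|right]; apply: card_le_trans Kb _; apply: subset_card_le.
  by move=> x [_ /asboolP].
by move=> x [[Ax|//]] /= /asboolP.
Qed.

Lemma card_option_le (M : cardinal) : infinite_card M ->
  [set: option M] #<= [set: M].
Proof.
move=> Minf; have [x _] := infinite_setN0 Minf.
have /card_le_funT[j [jP jinj]] := infinite_card_le_setD1 x Minf.
apply: (@card_le_inj _ _ _ _ (fun o => if o is Some m then j m else x)) => //.
move=> [m|] [n|] _ _ // h; first by rewrite (jinj _ _ h).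
  by have [_ []] := jP m.
by have [_ []] := jP n; rewrite h.
Qed.

(** Let C be cofinal in K, of cardinality cf K with an initial order R' of its
    own, and D cofinal in C for R'.  The elements of C that are R'-below a given
    d in D are fewer than cf K, hence have a bound k d in K; the k d for d in D
    are cofinal in K, so D has at least cf K elements.  R' is unrelated
    to the order of K, hence the passage to the bounds k d. *)
Lemma cf_idem (K : cardinal) : infinite_card K -> cf (cf K) #= [set: cf K].
Proof.
move=> Kinf; set C : cardinal := set_type (cf K).
have [R [iR cR bnd]] := cf_unbounded K.
have [R' [iR' cR' _]] := cf_unbounded C.
apply/card_eqPle; split; first exact: card_leT.
rewrite (card_le_eql (card_setT (cf K))).
have /choice[k kP] : forall d : C, exists k,
    forall c : C, R' c d -> R (val c) k.
  move=> d; have [|x xP] := bnd (val @` [set c : C | R' c d]).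
    apply: card_le_lt_trans (card_image_le _ _) _.
    apply: card_lt_le_trans (initial_order_le_lt _ _ iR') _.
      apply: card_le_infinite (infinite_cf Kinf).
      by rewrite (card_le_eqr (card_setT (cf K))).
    by rewrite (card_le_eql (card_setT (cf K))).
  by exists x => c cd; apply: (xP _ _).1; exists c.
apply: card_le_trans (card_image_le k (cf C)).
apply: contrapT => /card_ltNge /bnd[x xP].
have [c Cc xc] := cR x; have [d Cd cd] := cR' (SigSub (mem_set Cc)).
have [kx nkx] : R (k d) x /\ k d <> x by apply: xP; exists d.
apply: nkx; apply: (wo_anti iR.1) => //.
apply: (wo_trans iR.1 xc _); exact: kP cd.
Qed.

(** The least segment in which A embeds is also embedded in A, by the greedy
    principle: A does not embed in the segments below. *)
Lemma card_le_eq_segment (M : cardinal) (R : rel M) T (A : set T) :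
  well_order R -> A #< [set: M] -> exists x, A #= [set y | R y x /\ y <> x].
Proof.
move=> woR AM; have [|x Ax xmin] :=
    wo_min woR (P := [set x | A #<= [set y | R y x /\ y <> x]]).
  exact: card_lt_segment.
exists x; apply/card_eqPle; split=> //.
apply: (greedy_card_le (wo_wf woR) (wo_tri woR)) => y [yx nyx] Ay.
by apply: nyx; apply: (wo_anti woR) => //; exact: xmin.
Qed.

(** The class of a is the point of an initial order on M whose segment has the
    cardinality of lam a; [None] stands for the cardinality of M itself. *)
Lemma classify_cardinals_le (M : cardinal) (L : Type) (lam : L -> cardinal) :
  (forall a, [set: lam a] #<= [set: M]) ->
  exists p : L -> option M, forall a b, p a = p b -> [set: lam a] #= [set: lam b].
Proof.
move=> lamM; have [R [woR _]] := initial_order_ex M.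
have /choice[p pP] : forall a, exists o : option M,
    [set: lam a] #= if o is Some x then [set y | R y x /\ y <> x] else [set: M].
  move=> a; have [Ma|/card_ltNge aM] := pselect ([set: M] #<= [set: lam a]).
    by exists None; apply/card_eqPle.
  by have [x ax] := card_le_eq_segment woR aM; exists (Some x).
exists p => a b pab; apply: card_eq_trans (pP a) _; rewrite pab.
by rewrite card_eq_sym; exact: pP.
Qed.

Lemma classify_cardinals_lt_cf (K : cardinal) (L : Type) (lam : L -> cardinal) :
  infinite_card K -> ~ countable (cf K) -> ~ weakly_inaccessible (cf K) ->
  (forall a, [set: lam a] #< cf K) ->
  exists (S : cardinal) (p : L -> S), [set: S] #< cf K /\
    forall a b, p a = p b -> [set: lam a] #= [set: lam b].
Proof.
move=> Kinf Cunc nwi lamC.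
have eC := card_setT (cf K).
have Cinf : infinite_card (cf K).
  by apply: card_le_infinite (infinite_cf Kinf); rewrite (card_le_eqr eC).
have [M [MC Mmin]] : exists M : cardinal, successor_card M (cf K).
  apply: contrapT => nM; apply: nwi; split.
  - by rewrite /countable (card_le_eql eC).
  - by split=> //; exact: cf_idem.
  - by split=> //; exact: infinite_setN0.
have [|p pP] := @classify_cardinals_le M L lam.
  move=> a; apply/card_leNgt => /Mmin; rewrite (card_le_eql eC).
  exact/card_ltNge.
have Minf : infinite_card M.
  move=> Mfin; apply: Cunc; rewrite /countable -(card_le_eql eC); apply: Mmin.
  by apply: finite_card_lt => //; exact: infinite_nat.
exists (option M), p; split=> //.
apply: card_le_lt_trans (card_option_le Minf) _.
by apply: card_lt_le_trans MC _; rewrite (card_le_eql eC).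
Qed.

(** * Separating two maps on a large set *)

(** View i as an edge from f i to the smaller point g i, and colour the points
    recursively: v gets the colour that separates it from the majority of the
    points g i with f i = v.  At each v, the edges with ends of equal colours
    then inject into those with ends of different colours, and the injections
    for different v combine. *)
Lemma majority_colouring (I L : Type) (lt : L -> L -> Prop) (A : set I)
    (f g : I -> L) : well_founded lt -> (forall i, A i -> lt (g i) (f i)) ->
  exists c : L -> bool, [set i | A i /\ c (g i) = c (f i)] #<=
                        [set i | A i /\ c (g i) <> c (f i)].
Proof.
move=> wf gf.
have [c cE] := wf_rec (fun v (c : forall y, lt y v -> bool) => `[<
  [set i | A i /\ f i = v /\ exists p : lt (g i) v, c (g i) p = true] #<=
  [set i | A i /\ f i = v /\ exists p : lt (g i) v, c (g i) p = false] >]) wf.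
exists c.
(* both sets have f i = v, which makes the union over v of the injections
   injective *)
have maj v : [set i | A i /\ f i = v /\ c (g i) = c v] #<=
             [set i | A i /\ f i = v /\ c (g i) <> c v].
  have side b : [set i | A i /\ f i = v /\ exists p : lt (g i) v, c (g i) = b] =
                [set i | A i /\ f i = v /\ c (g i) = b].
    apply/seteqP; split=> [i [Ai [fi [_ e]]]|i [Ai [fi e]]] //.
    by split=> //; split=> //; rewrite -fi; exists (gf _ Ai).
  have /esym := cE v; rewrite !side; case E : (c v).
    move=> /asboolP; congr card_le; apply/seteqP.
    by split=> i [Ai [fi]] /=; case: (c (g i)).
  move=> /asboolP/card_ltNge/andP[+ _]; congr card_le; apply/seteqP.
  by split=> i [Ai [fi]] /=; case: (c (g i)).
have [->|/set0P[i0 _]] := eqVneq [set i | A i /\ c (g i) = c (f i)] set0.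
  exact: card_ge0.
have /choice[b bP] v := card_le_fun i0 (maj v).
apply: (@card_le_inj _ _ _ _ (fun i => b (f i) i)) => [i [Ai ci]|i j [Ai ci] [Aj cj]].
  by have [/(_ i)[//|? [e ?]] _] := bP (f i); split=> //; rewrite e.
move=> bij; have [/(_ i)[//|_ [ei _]] _] := bP (f i).
have [/(_ j)[//|_ [ej _]] _] := bP (f j).
have e : f i = f j by rewrite -ei bij ej.
by rewrite -e in bij; apply: (bP (f i)).2 bij; split=> //; split=> //; rewrite e.
Qed.

(** Orient the edges from f i to g i for a well-order of L, keep the more
    frequent orientation, and apply [majority_colouring]: K edges have ends of
    different colours, and among them K edges have the same colour at their
    f-end. *)
Lemma disjoint_images (K : cardinal) (I L : Type) (A : set I) (f g : I -> L) :
  infinite_card K -> [set: K] #<= A -> (forall i, A i -> f i <> g i) ->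
  exists J : set I, [/\ J `<=` A, [set: K] #<= J &
    forall i k, J i -> J k -> f i <> g k].
Proof.
move=> Kinf; have [R [woR _]] := initial_order_ex L.
pose lt x y := R x y /\ x <> y.
have core (B : set I) (u v : I -> L) : [set: K] #<= B ->
    (forall i, B i -> lt (v i) (u i)) ->
    exists J : set I, [/\ J `<=` B, [set: K] #<= J &
      forall i k, J i -> J k -> u i <> v k].
  move=> KB vu; have [c bad_le] := majority_colouring (wo_wf woR) vu.
  have KG : [set: K] #<= [set i | B i /\ c (v i) <> c (u i)].
    have [| |//] := @infinite_pigeonhole2 K _ [set i | B i /\ c (v i) = c (u i)]
      [set i | B i /\ c (v i) <> c (u i)] Kinf; last first.
      by move=> KB'; exact: card_le_trans KB' bad_le.
    apply: card_le_trans KB _; apply: subset_card_le => i Bi.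
    by have [?|?] := pselect (c (v i) = c (u i)); [left|right].
  have [| |] := @infinite_pigeonhole2 K _ [set i | B i /\ (c (u i) /\ ~~ c (v i))]
      [set i | B i /\ (~~ c (u i) /\ c (v i))] Kinf.
  - apply: card_le_trans KG _; apply: subset_card_le => i [Bi].
    by case Ev: (c (v i)); case Eu: (c (u i)) => // _;
      [right|left]; split=> //; rewrite Ev Eu.
  - move=> KJ; exists [set i | B i /\ (c (u i) /\ ~~ c (v i))]; split=> [i []//|//|].
    by move=> i k [_ [ci _]] [_ [_ ck]] e; move: ck; rewrite -e ci.
  - move=> KJ; exists [set i | B i /\ (~~ c (u i) /\ c (v i))]; split=> [i []//|//|].
    by move=> i k [_ [ci _]] [_ [_ ck]] e; move: ci; rewrite e ck.
move=> KA fg.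
have [| |] := @infinite_pigeonhole2 K _ (A `&` [set i | lt (g i) (f i)])
    (A `&` [set i | lt (f i) (g i)]) Kinf.
- apply: card_le_trans KA _; apply: subset_card_le => i Ai.
  by have [?|?] := wo_tri woR (fg i Ai); [right|left].
- move=> KB; have [|J [JB KJ JP]] := core _ f g KB; first by move=> i [].
  by exists J; split=> // i /JB[].
- move=> KB; have [|J [JB KJ JP]] := core _ g f KB; first by move=> i [].
  exists J; split=> // [i /JB[]//|i k Ji Jk e]; exact: JP Jk Ji (esym e).
Qed.

Lemma disjoint_images_seq (K : cardinal) (I : Type) (L : choiceType) (A : set I)
    (f : I -> L) (s : I -> seq L) n :
  infinite_card K -> [set: K] #<= A ->
  (forall i, A i -> size (s i) = n /\ f i \notin s i) ->
  exists J : set I, [/\ J `<=` A, [set: K] #<= J &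
    forall i k, J i -> J k -> f i \notin s k].
Proof.
move=> Kinf; elim: n A s => [|n IH] A s KA sP.
  exists A; split=> // i k Ai Ak; have [/size0nil -> _] := sP k Ak.
  by rewrite in_nil.
have [|J1 [J1A KJ1 J1P]] := IH A (fun i => behead (s i)) KA.
  by move=> i /sP[]; case: (s i) => //= x t [->]; rewrite in_cons negb_or => /andP[].
have [|J2 [J2J1 KJ2 J2P]] :=
    @disjoint_images K I L J1 f (fun i => head (f i) (s i)) Kinf KJ1.
  move=> i /J1A/sP[]; case: (s i) => //= x t _.
  by rewrite in_cons negb_or => /andP[/eqP].
exists J2; split=> // [i /J2J1/J1A//|i k Ji Jk].
have /J1A/sP[] := J2J1 _ Jk; have := J2P i k Ji Jk.
have := J1P i k (J2J1 _ Ji) (J2J1 _ Jk).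
case: (s k) => //= x t ft fx _ _; rewrite in_cons negb_or ft andbT.
exact/eqP.
Qed.

(** * Calibers of products *)

Lemma caliber_set (Z : topologicalType) (K I : cardinal) (A : set I)
    (U : I -> set Z) : caliber Z K -> [set: K] #<= A ->
  (forall i, A i -> open (U i) /\ U i !=set0) ->
  exists J : set I, [/\ J `<=` A, [set: K] #<= J &
    exists z, forall i, J i -> U i z].
Proof.
move=> calK /card_le_funT[e [eA einj]] UP.
have [||| J0 [KJ0 [z zP]]] := calK K (U \o e).
- exact: card_eqxx.
- by move=> k; exact: (UP _ (eA k)).1.
- by move=> k; exact: (UP _ (eA k)).2.
exists (e @` J0); split=> [_ [k _ <-]//||].
  rewrite -(card_le_eql KJ0).
  by apply: (@card_le_inj _ _ _ _ e) => [k Jk|k l _ _ /einj//]; exists k.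
by exists z => _ [k Jk <-]; exact: zP.
Qed.

Section product.
Context (K : cardinal) (L : choiceType) (Z : L -> topologicalType).
Context (Kinf : infinite_card K).
Context (calZ : forall a, caliber (Z a) K).
Context (S : cardinal) (p : L -> S).
Context (Scf : [set: S] #< cf K).
Context (homZ : forall a b, p a = p b -> homeomorphic (Z a) (Z b)).
Context (z0 : forall a, Z a).

(** Each V i matters only at its own coordinate f i.  After the pigeonhole
    principle all the factors at the coordinates f i are homeomorphic to one of
    them, where the caliber K applies.  Coordinates that coincide cause no
    conflict, since all of them receive copies of the same point w. *)
Lemma caliber_coordinate (I : cardinal) (A : set I) (f : I -> L)
    (V : I -> forall a, set (Z a)) : [set: K] #<= A ->
  (forall i, A i -> open (V i (f i)) /\ V i (f i) !=set0) ->
  exists J : set I, [/\ J `<=` A, [set: K] #<= J &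
    exists y : forall a, Z a, forall i, J i -> V i (f i) (y (f i))].
Proof.
move=> KA VP; have [s Ks] := cf_pigeonhole (p \o f) Kinf KA Scf.
have [i0 [_ fi0]] := infinite_setN0 (card_le_infinite Ks Kinf).
have hE : forall a, exists h : Z (f i0) -> Z a,
    p a = s -> continuous h /\ forall z, exists w, h w = z.
  move=> a; have [pa|npa] := pselect (p a = s); last by exists (fun=> z0 a).
  have [|h [k [hc kc hk kh]]] := @homZ (f i0) a; first by rewrite pa.
  by exists h => _; split=> // z; exists (k z).
pose h a := projT1 (cid (hE a)).
have hP a : p a = s -> continuous (h a) /\ forall z, exists w, h a w = z.
  exact: projT2 (cid (hE a)).
have [|J [JA KJ [w wP]]] := caliber_set (U := fun i => h (f i) @^-1` V i (f i))
    (@calZ (f i0)) Ks.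
  move=> i [Ai fi]; have [hc hs] := hP _ fi; have [oV [v Vv]] := VP _ Ai; split.
    by apply: open_comp => // z _; exact: hc.
  by have [u hu] := hs v; exists u; rewrite /preimage/= hu.
by exists J; split=> // [i /JA[]//|]; exists (fun a => h a w) => i /wP.
Qed.

(** Induction on the number of restricted coordinates.  A solution y1 for the
    tails and a solution y2 for the heads are glued: y2 is used at the heads and
    y1 elsewhere, which is possible once no head is in a tail, by
    [disjoint_images_seq]. *)
Lemma caliber_finite_support (I : cardinal) (V : I -> forall a, set (Z a)) n
    (A : set I) (s : I -> seq L) : [set: K] #<= A ->
  (forall i, A i -> [/\ size (s i) = n, uniq (s i) &
    forall a, a \in s i -> open (V i a) /\ V i a !=set0]) ->
  exists J : set I, [/\ J `<=` A, [set: K] #<= J &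
    exists y : forall a, Z a, forall i a, J i -> a \in s i -> V i a (y a)].
Proof.
elim: n A s => [|n IH] A s KA sP.
  exists A; split=> //; exists z0 => i a Ai.
  by have [/size0nil -> _ _] := sP i Ai; rewrite in_nil.
have [l0] : exists l : L, True.
  have [i Ai] := infinite_setN0 (card_le_infinite KA Kinf).
  by have [] := sP i Ai; case: (s i) => // l; exists l.
pose f i := head l0 (s i); pose t i := behead (s i).
have sE i : A i -> s i = f i :: t i.
  by move=> /sP[]; rewrite /f /t; case: (s i).
move=> _; have [|J1 [J1A KJ1 [y1 y1P]]] := IH A t KA.
  move=> i Ai; have [] := sP i Ai; rewrite sE //= => -[st] /andP[_ ut] sV.
  by split=> // a ta; apply: sV; rewrite in_cons ta orbT.
have [|J2 [J2J1 KJ2 [y2 y2P]]] := @caliber_coordinate _ _ f V KJ1.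
  by move=> i /J1A Ai; have [_ _] := sP i Ai; apply; rewrite sE // mem_head.
have [|J [JJ2 KJ JP]] := @disjoint_images_seq K _ _ _ f t n Kinf KJ2.
  move=> i /J2J1/J1A Ai; have [] := sP i Ai; rewrite sE //= => -[->].
  by move=> /andP[].
exists J; split=> // [i /JJ2/J2J1/J1A//|].
exists (fun a => if pselect (exists2 i, J i & f i = a) then y2 a else y1 a).
move=> i a Ji; rewrite sE; last exact/J1A/J2J1/JJ2.
rewrite in_cons => /orP[/eqP ->|ta]; case: pselect => // h.
- by apply: y2P; exact: JJ2.
- by case: h; exists i.
- by case: h => k Jk fk; have := JP k i Jk Ji; rewrite fk ta.
- by apply: y1P => //; exact/J2J1/JJ2.
Qed.

(** The sets containing an open box around g form a filter, which converges to g
    because it does so at each coordinate; hence it contains U. *)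
Lemma prod_topology_box (g : prod_topology Z) (U : set (prod_topology Z)) :
  open U -> U g -> exists (s : seq L) (V : forall a, set (Z a)),
    [/\ uniq s, forall a, open (V a) /\ V a (g a) &
      forall h : prod_topology Z, (forall a, a \in s -> V a (h a)) -> U h].
Proof.
move=> oU Ug.
pose F : set_system (prod_topology Z) :=
  [set P | exists (s : seq L) (V : forall a, set (Z a)),
  (forall a, open (V a) /\ V a (g a)) /\
  forall h : prod_topology Z, (forall a, a \in s -> V a (h a)) -> P h].
have FF : Filter F.
  split.
  - by exists [::], (fun=> setT); split=> // a; split=> //; exact: openT.
  - move=> P Q [s [V [VP sP]]] [t [W [WP tQ]]].
    exists (s ++ t), (fun a => V a `&` W a); split=> [a|h hP].
      by have [? ?] := VP a; have [? ?] := WP a; split=> //; exact: openI.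
    split; [apply: sP|apply: tQ] => a sa.
      by have [] := hP a; rewrite // mem_cat sa.
    by have [] := hP a; rewrite // mem_cat sa orbT.
  - move=> P Q PQ [s [V [VP sP]]]; exists s, V; split=> // h /sP; exact: PQ.
have Fg : F --> g.
  apply/cvg_sup => a P [_ [[W oW <-] Wg WP]].
  exists [:: a], (fun b => if pselect (b = a) is left e
    then ecast b (set (Z b)) (esym e) W else setT).
  split=> [b|h hP].
    case: pselect => [e|_]; last by split=> //; exact: openT.
    by subst b.
  apply: WP; have := hP a (mem_head _ _); case: pselect => // e.
  by rewrite /preimage /= (Prop_irrelevance (esym e) erefl).
have [s [V [VP sU]]] : F U by apply: Fg; exact: open_nbhs_nbhs.
exists (undup s), V; split=> //; first exact: undup_uniq.
by move=> h hP; apply: sU => a sa; apply: hP; rewrite mem_undup.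
Qed.

(** As cf K is uncountable, K of the supports have the same size. *)
Lemma caliber_prod_topology : ~ countable (cf K) -> caliber (prod_topology Z) K.
Proof.
move=> Kunc I U IK oU nU.
have /choice[g gP] := nU.
have /choice[s sP] i := prod_topology_box (oU i) (gP i).
have /choice[V VP] := sP.
have [| |n Kn] := @cf_pigeonhole K I setT nat (size \o s) Kinf.
- by rewrite -(card_le_eql IK).
- exact/card_ltNge.
have [|J [_ KJ [y yP]]] := @caliber_finite_support _ V n _ s Kn.
  move=> i [_ si]; have [us Vi _] := VP i; split=> // a _.
  by have [? ?] := Vi a; split=> //; exists (g i a).
exists J; split.
  apply/card_eqPle; split=> //; apply: card_le_trans (card_leT J) _.
  by rewrite (card_le_eql IK).
by exists y => i Ji; have [_ _] := VP i; apply => a; exact: yP.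
Qed.

End product.

Lemma caliber_image (Y Z : topologicalType) (K : cardinal) (h : Y -> Z) :
  continuous h -> (forall z, exists y, h y = z) -> caliber Y K -> caliber Z K.
Proof.
move=> hc hs calY I U IK oU nU.
have [||J [JK [y yP]]] := calY I (fun i => h @^-1` U i) IK.
- by move=> i; apply: open_comp => // y _; exact: hc.
- move=> i; have [z Uz] := nU i; have [y hy] := hs z.
  by exists y; rewrite /preimage/= hy.
by exists J; split=> //; exists (h y).
Qed.

(** * Function spaces of topological sums *)

Section Cp.
Context (R : realType).
Implicit Type X : topologicalType.

Definition Cp_of X (f : X -> R) (cf : continuous f) : Cp R X :=
  SigSub (mem_set (cf : [set f : {ptws X -> R} | continuous (f : X -> R)] f)).

Definition Cp_eval X (x : X) (f : Cp R X) : R := \val f x.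

Lemma Cp_eval_continuous X (x : X) : continuous (Cp_eval x).
Proof.
move=> f.
apply: (@continuous_comp _ _ _ (\val : Cp R X -> {ptws X -> R}) (fun g => g x)).
  exact: initial_continuous.
exact: (@proj_continuous X (fun=> R) x).
Qed.

(** Universal property of pointwise convergence. *)
Lemma Cp_continuous X (T : topologicalType) (h : T -> Cp R X) :
  (forall x, continuous (Cp_eval x \o h)) -> continuous h.
Proof.
move=> hc t P [_ [[B oB <-] Bht BP]].
suff : (fun t => \val (h t)) @ t --> (\val (h t) : {ptws X -> R}).
  move=> /(_ B (open_nbhs_nbhs (conj oB Bht))) tB.
  have {}tB : nbhs t (fun u => B (\val (h u))) := tB.
  by apply: (filterS _ tB) => u Bu; exact: BP.
apply/cvg_sup => x Q [_ [[W oW <-] Wg WQ]].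
have /(_ W) := hc x t; rewrite /= => /(_ (open_nbhs_nbhs (conj oW Wg))) tW.
have {}tW : nbhs t (fun u => W (Cp_eval x (h u))) := tW.
by apply: (filterS _ tW) => u Wu; exact: WQ.
Qed.

Lemma Cp_valP X (f : Cp R X) : continuous (fun x => Cp_eval x f).
Proof. exact: set_mem (valP f). Qed.

Lemma Cp_ext X (f g : Cp R X) : (forall x, Cp_eval x f = Cp_eval x g) -> f = g.
Proof. by move=> fg; apply: val_inj; apply: funext => x; exact: fg. Qed.

(** The balls of radius 1/2 around the natural numbers are pairwise disjoint,
    and so are their preimages under the evaluation at x, which are nonempty
    because of the constant functions. *)
Lemma caliber_nat_Cp_empty X : caliber (Cp R X) nat -> X -> False.
Proof.
move=> cal x; pose B (n : nat) : set R := ball (n%:R : R)%R (1/2)%R.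
have [|||J [Jinf [f fP]]] := cal nat (fun n => Cp_eval x @^-1` B n).
- exact: card_eqxx.
- move=> n; apply: open_comp => [y _|]; first exact: Cp_eval_continuous.
  exact: ball_open.
- move=> n; exists (Cp_of (@cst_continuous X R (n%:R)%R)).
  by rewrite /preimage /=; apply: ballxx.
have Jinf' : infinite_set J by apply/infiniteP; rewrite (card_le_eqr Jinf).
have [m Jm] := infinite_setN0 Jinf'.
have [n [Jn nm]] : (J `\ m) !=set0.
  by apply: infinite_setN0; apply: infinite_setD.
suff lt_contra i j : J i -> J j -> (i < j)%N -> False.
  by apply: nm; case: (ltngtP n m) => //= /lt_contra[].
move=> Ji Jj; rewrite -(@ler_nat R) -natr1; have := fP _ Ji; have := fP _ Jj.
rewrite /preimage /B /ball /= !ltr_norml; lra.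
Qed.

Section sum.
Context (L : choiceType) (X : L -> topologicalType).

Lemma summand_continuous (a : L) (f : Cp R {a : L & X a}) :
  continuous (fun x => Cp_eval (existT X a x) f).
Proof.
move=> x; apply: (@continuous_comp _ _ _ (existT X a) (fun y => Cp_eval y f)).
  exact: existT_continuous.
exact: Cp_valP.
Qed.

Definition Cp_restrict (a : L) (f : Cp R {a : L & X a}) : Cp R (X a) :=
  Cp_of (@summand_continuous a f).

Lemma Cp_restrict_continuous a : continuous (@Cp_restrict a).
Proof. by apply: Cp_continuous => x; exact: Cp_eval_continuous. Qed.

Definition Cp_glue (z : prod_topology (fun a => Cp R (X a))) :
    Cp R {a : L & X a} :=
  Cp_of (@sigT_continuous L X R (fun a x => Cp_eval x (z a))
    (fun a => @Cp_valP (X a) (z a))).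

Lemma Cp_glue_continuous : continuous Cp_glue.
Proof.
apply: Cp_continuous => -[a x] z.
pose Y := prod_topology (fun a => Cp R (X a)).
change {for z, continuous (fun z : Y => Cp_eval x (z a))}.
apply: (@continuous_comp Y _ _ (fun z => z a) (Cp_eval x)).
  exact: (@proj_continuous L (fun a => Cp R (X a)) a).
exact: Cp_eval_continuous.
Qed.

Lemma Cp_glueK f : Cp_glue (fun a => Cp_restrict a f) = f.
Proof. by apply: Cp_ext => -[a x]. Qed.

(** Extend a function on one summand by 0. *)
Lemma Cp_restrict_surj a g : exists f, Cp_restrict a f = g.
Proof.
pose z b : Cp R (X b) := if pselect (a = b) is left e then
  ecast c (Cp R (X c)) e g else Cp_of (@cst_continuous (X b) R 0%R).
have zE : z a = g.
  by rewrite /z; case: pselect => [e|//]; rewrite (Prop_irrelevance e erefl).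
exists (Cp_glue z); apply: Cp_ext => x.
by change (Cp_eval x (z a) = Cp_eval x g); rewrite zE.
Qed.

End sum.
End Cp.

(** * The theorem *)

Lemma Cp_subsingleton (R : realType) (X : topologicalType) (K : cardinal) :
  (X -> False) -> caliber (Cp R X) K.
Proof.
move=> X0 I U IK _ nU; exists setT; split=> //.
exists (Cp_of (@cst_continuous X R 0%R)) => i _.
by have [f Uf] := nU i; rewrite (_ : Cp_of _ = f) //; apply: Cp_ext => x.
Qed.

(** An infinite cardinal has infinite cofinality, so cf K is at most the
    cofinality of aleph_0. *)
Lemma lt_countable_cf_lt_cf_nat (K : cardinal) T (A : set T) :
  countable (cf K) -> A #< cf K -> A #< cf nat.
Proof.
move=> Kc AK; apply: card_lt_le_trans AK _; apply: card_le_trans Kc _.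
by apply/infiniteP; exact: infinite_cf infinite_nat.
Qed.

Theorem corollary8p8 (R : realType) (L : choiceType)
    (X : L -> topologicalType) (lam : L -> cardinal)
    (hX : forall a, tychonoff_space (X a))
    (hcal : forall (a : L) (K : cardinal),
      in_calibers (Cp R (X a)) K <->
        infinite_card K /\ [set: lam a] #< cf K)
    (hhomeo : forall a b : L, [set: lam a] #= [set: lam b] ->
      homeomorphic (Cp R (X a)) (Cp R (X b)))
    (hwi : forall K : cardinal, infinite_card K ->
      (forall a : L, in_calibers (Cp R (X a)) K) ->
      ~ weakly_inaccessible (cf K)) :
  forall K : cardinal,
    in_calibers (Cp R {a : L & X a}) K <->
      infinite_card K /\ (forall a : L, in_calibers (Cp R (X a)) K).
Proof.
move=> K; split=> [[Kinf calK]|[Kinf calK]].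
  split=> // a; split=> //.
  apply: caliber_image calK; first exact: (@Cp_restrict_continuous R L X a).
  exact: Cp_restrict_surj.
split=> //.
have lamK a : [set: lam a] #< cf K by have /hcal[] := calK a.
have [Kcount|Kuncount] := pselect (countable (cf K)).
  apply: Cp_subsingleton => -[a x].
  have [|_ cal] := (hcal a nat).2; last exact: caliber_nat_Cp_empty cal x.
  by split; [exact: infinite_nat|exact: lt_countable_cf_lt_cf_nat (lamK a)].
have [S [p [Scf pP]]] :=
  classify_cardinals_lt_cf Kinf Kuncount (hwi K Kinf calK) lamK.
apply: (caliber_image (@Cp_glue_continuous R L X)).
  by move=> f; exists (fun a => Cp_restrict a f); exact: Cp_glueK.
apply: (caliber_prod_topology Kinf (fun a => (calK a).2) Scf) => //.
  by move=> a b /pP; exact: hhomeo.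
by move=> a; exact: (Cp_of (@cst_continuous (X a) R 0%R)).
Qed.
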